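(* Let $d\ge 2$ be an integer and let $P(x)\in\mathbb{Z}[x]$ be a separable polynomial of degree $d$ with roots $\alpha_1=\alpha,\ \alpha_2=\beta,\ \alpha_3,\ldots,\alpha_d\in\mathbb{C}$, such that $\alpha_i+\alpha_j\neq 0$ for all $i,j\in\{1,\ldots,d\}$ (including $i=j$). If $\alpha$ and $\beta$ are real, then $$\big||\alpha|-|\beta|\big|\geq 2^{(-d^2+2)/2}\,(d+1)^{(-d+1)/2}\,\mathrm{H}(P)^{-d+1}.$$ Moreover, the exponent $-d+1$ of $\mathrm{H}(P)$ is best possible: for every integer $d\ge 2$, every real number $e>-d+1$ and every real number $c>0$, there exists a separable polynomial $P(x)\in\mathbb{Z}[x]$ of degree $d$, no two (not necessarily distinct) of whose complex roots sum to $0$, having two distinct real roots $\alpha,\beta$ with $\big||\alpha|-|\beta|\big|<c\,\mathrm{H}(P)^{e}$.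
   Context: The height $\mathrm{H}(P)$ of a polynomial $P$ with integer coefficients is the maximum of the absolute values of its coefficients. A polynomial is called separable if it has no multiple roots in $\mathbb{C}$; thus $\alpha_1,\ldots,\alpha_d$ are pairwise distinct. *)

(* Defs.v *)
From HB Require Import structures.
From mathcomp Require Import all_boot all_order all_algebra.
From mathcomp Require Import reals exp.
From mathcomp Require Import complex.

Set Implicit Arguments.
Unset Strict Implicit.
Unset Printing Implicit Defensive.

Import Order.TTheory GRing.Theory Num.Theory.

Local Open Scope ring_scope.

Definition height (P : {poly int}) : nat := \max_(i < size P) absz (P`_i)%R.

(* The field of complex numbers is R[i], for R any model of the reals. *)
Definition complex_poly (R : realType) (P : {poly int}) : {poly R[i]} :=
  map_poly intr P.

(* This notion differs from separable_poly (coprimality with the derivative)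
   only in being phrased through multiple complex roots. *)
Definition no_multiple_root (R : realType) (P : {poly int}) : Prop :=
  forall z : R[i], ~~ (('X - z%:P) ^+ 2 %| complex_poly R P).

(* Main.v *)
Require Import Defs.
From HB Require Import structures.
From mathcomp Require Import all_boot all_order all_algebra.
From mathcomp Require Import boolp reals exp.
From mathcomp Require Import complex.
From mathcomp Require Import algC algnum zify ring lra.

(** Write a for the leading coefficient of P, d for its degree and z_1, ..., z_d
    for its roots.

    Lower bound. Depending on the signs of alpha and beta, the quantity
    | |alpha| - |beta| | is |alpha - beta| or |alpha + beta|, so it is
    |alpha + e beta| for a sign e. Consider
      E = a^(d-1) prod_(i < j) (z_i + e z_j).
    Every root occurs d-1 times in this product, so expanding it writes E as an
    integer combination of products of d-1 factors of the form
    a prod_(i in S) z_i. Each such factor is an algebraic integer, because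
    dividing a polynomial with algebraic integer coefficients by X - z, for one
    of its roots z, leaves algebraic integer coefficients ([integral_divXsubC]).
    On the other hand E^2 is, up to sign, a power of a times
    prod_i prod_(j <> i) (z_i + e z_j), and the inner products are values of
    rational polynomials at the roots (P' if e = -1, P(-X) / 2X if e = 1).
    Hence E^2 is rational ([rational_prod_horner]), so it is an integer; it is
    not 0, and |E| >= 1 ([lead_pairs_ge1]).
    Bounding every factor of E but alpha + e beta by
    2 max(1, |z_i|) max(1, |z_j|) gives
      2 <= |alpha + e beta| 2^(d(d-1)/2) M^(d-1),
    where M = |a| prod_i max(1, |z_i|) is the Mahler measure of P, and M is at
    most the l^2 norm of the coefficients ([landau]), so at most
    sqrt(d+1) H(P).

    Sharpness. Let k = d-1 and r = 1 - 1/n. The two terms of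
      A (1 + X)^k (n X - (n - 1)) + (1 - X)^k (n X + (n - 1))
    are exchanged up to sign by X -> -X, the first one vanishes at r and is tiny
    at -r, the second one vanishes at -r and is tiny at r: both are of order
    n^(1-k) there, while the derivative is of order n. So there are real roots
    within O(n^-k) of r and of -r, and the height is O(n). When A > 1 the
    symmetry excludes two roots with sum 0. A double root z has a square that
    does not depend on A, and the symmetry again forbids this for two values of
    A at once; hence A = 2 or A = 3 gives a separable polynomial. The estimates
    need k >= 2; in degree 2 the polynomial n X^2 + X - n does the job. *)

Set Implicit Arguments.
Unset Strict Implicit.
Unset Printing Implicit Defensive.

Import Order.TTheory GRing.Theory Num.Theory.

Local Open Scope ring_scope.

(** * Integrality of pair products of roots *)

(** The tool for all degree counts: each unordered pair of indices carries both
    ordered pairs. *)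
Lemma big_offdiag (T : Type) (idx : T) (op : Monoid.com_law idx) n (F : 'I_n -> 'I_n -> T) :
  \big[op/idx]_i \big[op/idx]_(j | j != i) F i j =
  \big[op/idx]_(p : 'I_n * 'I_n | (p.1 < p.2)%N) op (F p.1 p.2) (F p.2 p.1).
Proof.
rewrite pair_big_dep /= (bigID (fun p : 'I_n * 'I_n => (p.1 < p.2)%N)) big_split /=; congr (op _ _).
  apply: eq_bigl => -[i j] /=; rewrite andbC; case: ltnP => //= lt.
  by rewrite -val_eqE /= gtn_eqF.
rewrite (reindex_onto (fun p : 'I_n * 'I_n => (p.2, p.1)) (fun p => (p.2, p.1))) => [|[]//].
apply: eq_bigl => -[i j] /=; rewrite eqxx andbT -leqNgt -val_eqE /=.
by rewrite leq_eqVlt; case: ltngtP.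
Qed.

Section Integral.
Variable K : fieldType.
Notation integral := (integralOver (intr : int -> K)).

(** Multiplying p(z) = 0 by a power of the leading coefficient a turns it into
    a monic equation for a z. As n + 1 only bounds the degree, a may vanish. *)
Lemma integral_lead_mul_root n (p : {poly K}) z : (size p <= n.+2)%N ->
  (forall i, integral p`_i) -> root p z -> integral (p`_n.+1 * z).
Proof.
move=> sp ip /rootP pz0; set a := p`_n.+1.
pose q : {poly K} := \poly_(i < n.+2) (if i == n.+1 then 1 else p`_i * a ^+ (n - i)).
have sq : size q = n.+2 by rewrite size_poly_eq // eqxx oner_neq0.
apply: (@integral_root_monic _ _ _ _ q).
- by rewrite monicE lead_coefE sq coef_poly ltnSn eqxx.
- suff e : q.[a * z] = a ^+ n * p.[z] by apply/rootP; rewrite e pz0 mulr0.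
  rewrite (horner_coef_wide _ (eq_leq sq)) (horner_coef_wide _ sp) big_distrr /=.
  apply: eq_bigr => i _.
  rewrite coef_poly ltn_ord; case: eqP => [->|/eqP ne].
    by rewrite mul1r exprMn -/a [a ^+ n.+1]exprSr mulrA.
  have le : (i <= n)%N by have := ltn_ord i; lia.
  have -> : a ^+ n = a ^+ (n - i) * a ^+ i by rewrite -exprD subnK.
  by rewrite exprMn; ring.
apply/integral_poly=> i; rewrite coef_poly; case: ifP => _; last exact: integral0.
case: eqP => _; first exact: integral1.
apply: integral_mul; first exact: ip.
elim: (n - i)%N => [|k ih]; first exact: integral1.
by rewrite exprS; apply: integral_mul => //; apply: ip.
Qed.

(** Induction on the degree: with a the leading coefficient of q, both a and
    a z are integral, so a X^n can be subtracted from q and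
    a X^n (X - z) from the product. *)
Lemma integral_divXsubC (q : {poly K}) z :
  (forall i, integral (('X - z%:P) * q)`_i) -> forall i, integral q`_i.
Proof.
have [n] := ubnP (size q); elim: n q => // -[|n] ih q sq iq i.
  move: sq; rewrite ltnS leqn0 size_poly_eq0 => /eqP ->.
  by rewrite coef0; apply: integral0.
pose a := q`_n.
have sp : (size (('X - z%:P) * q)%R <= n.+2)%N.
  by apply: leq_trans (size_polyMleq _ _) _; rewrite size_XsubC.
have ea : (('X - z%:P) * q)`_n.+1 = a.
  by rewrite mulrBl coefB coefXM /= coefCM [q`_n.+1]nth_default ?mulr0 ?subr0.
have ia : integral a by rewrite -ea.
have iaz : integral (a * z).
  by rewrite -ea; apply: integral_lead_mul_root => //; rewrite rootM root_XsubC eqxx.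
have -> : q = (q - a *: 'X^n) + a *: 'X^n by rewrite subrK.
rewrite coefD; apply: integral_add; last first.
  rewrite coefZ coefXn; apply: integral_mul => //.
  by case: eqP => _; [apply: integral1 | apply: integral0].
apply: ih i => [|i].
  rewrite ltnS; apply/leq_sizeP => j; rewrite leq_eqVlt => /predU1P [<-|lt].
    by rewrite coefB coefZ coefXn eqxx mulr1 subrr.
  rewrite coefB coefZ coefXn gtn_eqF // mulr0 subr0 nth_default //.
  by apply: leq_trans lt; rewrite -ltnS.
rewrite mulrBr coefB; apply: integral_sub => //.
rewrite -scalerAr mulrBl -exprS coefZ coefB coefXn coefCM coefXn mulrBr.
apply: integral_sub.
  by apply: integral_mul => //; case: eqP => _; [apply: integral1 | apply: integral0].
rewrite mulrA; apply: integral_mul => //.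
by case: eqP => _; [apply: integral1 | apply: integral0].
Qed.

(** Removing the other linear factors one by one keeps the coefficients
    integral; the constant coefficient of what remains is the product, up to
    sign. *)
Lemma integral_lead_prod_roots (I : finType) (S : pred I) a (z : I -> K) :
  (forall i, integral (a *: \prod_i ('X - (z i)%:P))`_i) ->
  integral (a * \prod_(i | S i) z i).
Proof.
rewrite (bigID S) /= => ip.
have {ip} : forall k, integral (a *: \prod_(i | S i) ('X - (z i)%:P))`_k.
  move: ip; set p := \prod_(i | S i) _; rewrite -mul_polyC mulrA mulrC mul_polyC.
  elim/big_rec: _ => [|i q _ ih] ip; first by move: ip; rewrite mul1r.
  by apply: ih; apply: integral_divXsubC; rewrite mulrA.
move/(_ 0%N); rewrite coefZ coef0_prod.
under eq_bigr do rewrite coefB coefX coefC sub0r.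
rewrite prodrN mulrCA => h.
have iN1 k : integral ((-1) ^+ k).
  by rewrite -signr_odd; case: odd; rewrite ?expr1 ?expr0; [apply/integral_opp/integral1 | apply: integral1].
by have := integral_mul (iN1 #|[pred i | S i]|) h; rewrite signrMK.
Qed.

(** One factor a is spent on the product of all the roots that occur, and this
    lowers every positive exponent by one. *)
Lemma integral_lead_monomial (I : finType) a (z : I -> K) N (m : I -> nat) :
  (forall i, integral (a *: \prod_i ('X - (z i)%:P))`_i) ->
  (forall i, (m i <= N)%N) -> integral (a ^+ N * \prod_i z i ^+ m i).
Proof.
move=> ip; elim: N m => [|N ih] m le.
  rewrite mul1r big1 => [|i _]; first exact: integral1.
  by have := le i; rewrite leqn0 => /eqP ->.
have -> : a ^+ N.+1 * \prod_i z i ^+ m i =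
    (a * \prod_(i | (0 < m i)%N) z i) * (a ^+ N * \prod_i z i ^+ (m i).-1).
  rewrite exprS [in RHS]mulrACA [X in _ = _ * (X * _)]big_mkcond /= -big_split /=.
  by congr (_ * _); apply: eq_bigr => i _; case: (m i) => [|k]; rewrite ?mulr1 ?exprS.
apply: integral_mul; first exact: integral_lead_prod_roots.
by apply: ih => i; have := le i; case: (m i).
Qed.

(** A sum over orientations of the edges in L, expanded one edge at a time:
    [m] records the multiplicities of the endpoints chosen so far, and the
    degree condition bounds the final multiplicities by N for any choice. *)
Lemma integral_lead_edges (I : finType) a (z : I -> K) e N (m : I -> nat)
    (L : seq (I * I)) (Q : pred (I * I)) :
  (forall i, integral (a *: \prod_i ('X - (z i)%:P))`_i) -> integral e ->
  (forall i, (m i + \sum_(p <- L | Q p) ((i == p.1) + (i == p.2)) <= N)%N) ->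
  integral (a ^+ N * \prod_i z i ^+ m i * \prod_(p <- L | Q p) (z p.1 + e * z p.2)).
Proof.
move=> ip ie; elim: L m => [|[x y] L ih] m le.
  rewrite big_nil mulr1; apply: integral_lead_monomial => // i.
  by have := le i; rewrite big_nil addn0.
rewrite big_cons /=; case: ifP => Qxy; last first.
  by apply: ih => i; have := le i; rewrite big_cons Qxy.
have bump k : \prod_i z i ^+ (m i + (i == k)) = (\prod_i z i ^+ m i) * z k.
  under eq_bigr do rewrite exprD.
  rewrite big_split /=; congr (_ * _).
  by rewrite (bigD1 k) //= eqxx big1 ?mulr1 // => i /negPf ->.
have {le} le i : (m i + ((i == x) + (i == y) + \sum_(p <- L | Q p) ((i == p.1) + (i == p.2))) <= N)%N.
  by have := le i; rewrite big_cons Qxy.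
have hx := ih (fun i => m i + (i == x))%N _.
have hy := ih (fun i => m i + (i == y))%N _.
rewrite !bump in hx hy.
set R := \prod_(p <- L | Q p) _ in hx hy *.
have -> : a ^+ N * \prod_i z i ^+ m i * ((z x + e * z y) * R) =
   a ^+ N * (\prod_i z i ^+ m i * z x) * R + e * (a ^+ N * (\prod_i z i ^+ m i * z y) * R).
  by ring.
apply: integral_add; first by apply: hx => i; apply: leq_trans (le i); lia.
by apply: integral_mul => //; apply: hy => i; apply: leq_trans (le i); lia.
Qed.

Lemma integral_lead_pairs n a (z : 'I_n -> K) e :
  (forall i, integral (a *: \prod_i ('X - (z i)%:P))`_i) -> integral e ->
  integral (a ^+ n.-1 * \prod_(p : 'I_n * 'I_n | (p.1 < p.2)%N) (z p.1 + e * z p.2)).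
Proof.
move=> ip ie.
have := @integral_lead_edges _ a z e n.-1 (fun=> 0%N) (index_enum _)
  (fun p => (p.1 < p.2)%N) ip ie.
rewrite [X in a ^+ _ * X]big1 // mulr1; apply => i; rewrite add0n.
rewrite -(big_offdiag _ (fun j k => nat_of_bool (i == j))) /=.
rewrite (bigD1 i) //= eqxx addnC big1 => [|j /negPf ne]; last first.
  by rewrite big1 // => k _; rewrite eq_sym ne.
by rewrite sum1_card add0n cardC1 card_ord.
Qed.
End Integral.

(** * Rationality, and a lower bound for pair products *)

(** The product is the determinant of multiplication by g modulo p, which is a
    rational matrix M in the basis of powers of X; the Vandermonde matrix V of
    the roots diagonalises it, M V = V diag(g(z_i)). *)
Lemma rational_prod_horner (C : numFieldType) n (z : 'I_n -> C) (p g : {poly rat}) a :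
  injective z -> map_poly ratr p = a *: \prod_i ('X - (z i)%:P) -> a != 0 ->
  exists q : rat, \prod_i (map_poly ratr g).[z i] = ratr q.
Proof.
move=> zI ep a0.
have sp : size p = n.+1.
  rewrite -(size_map_poly (ratr : rat -> C)) ep size_scale // size_prod_XsubC.
  by rewrite /index_enum -enumT size_enum_ord.
pose r j := ('X^j * g) %% p.
pose M : 'M[rat]_n := \matrix_(j, k) (r j)`_k.
pose V := Vandermonde n (\row_i z i).
pose G := \row_i (map_poly ratr g).[z i].
have e : map_mx ratr M *m V = V *m diag_mx G.
  apply/matrixP => j i; rewrite mul_mx_diag !mxE.
  under eq_bigr do rewrite !mxE -coef_map /=.
  have sr : (size (map_poly (ratr : rat -> C) (r j)) <= n)%N.
    by rewrite size_map_poly -ltnS -sp ltn_modp -size_poly_eq0 sp.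
  rewrite -(horner_coef_wide _ sr).
  have := congr1 (fun q => (map_poly (ratr : rat -> C) q).[z i]) (divp_eq ('X^j * g) p).
  rewrite rmorphD !rmorphM /= map_polyXn hornerD !hornerM hornerXn => ->.
  have -> : (map_poly ratr p).[z i] = 0.
    by rewrite ep hornerZ horner_prod (bigD1 i) //= hornerXsubC subrr mul0r mulr0.
  by rewrite mulr0 add0r.
have Vn0 : \det V != 0.
  rewrite det_Vandermonde; apply/prodf_neq0 => i _; apply/prodf_neq0 => j lt.
  by rewrite !mxE subr_eq0; apply: contraTneq lt => /zI ->; rewrite ltnn.
exists (\det M); have := congr1 determinant e.
rewrite !det_mulmx det_diag mulrC det_map_mx => /(mulfI Vn0) ->.
by apply: eq_bigr => i _; rewrite mxE.
Qed.

(** A monic integer equation of a rational number also holds in the field of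
    algebraic numbers, where rational algebraic integers are integers. *)
Lemma integral_rational_int (C : numFieldType) q :
  integralOver (intr : int -> C) (ratr q) -> exists k : int, q = k%:~R.
Proof.
case=> p mp /rootP rp.
have rq : (map_poly intr p : {poly rat}).[q] = 0.
  apply: (fmorph_inj (ratr : rat -> C)); rewrite rmorph0 -horner_map -map_poly_comp /= -{}rp.
  by congr (_.[_]); apply: eq_map_poly => k /=; rewrite rmorph_int.
have : (ratr q : algC) \in Num.int.
  apply: Cint_rat_Aint; first exact: Crat_rat.
  apply: (@root_monic_Aint (map_poly intr p)).
  - apply/rootP; rewrite -[RHS](rmorph0 (ratr : rat -> algC)) -rq -horner_map -map_poly_comp /=.
    by congr (_.[_]); apply: eq_map_poly => k /=; rewrite rmorph_int.
  - exact: monic_map.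
  by apply/polyOverP => i; rewrite coef_map /= intr_int.
case/intrP => k ek; exists k; apply: (fmorph_inj (ratr : rat -> algC)).
by rewrite /= ek rmorph_int.
Qed.

Section Pairs.
Variables (C : numFieldType) (n : nat) (z : 'I_n -> C) (P : {poly int}) (a : C).
Hypothesis eP : map_poly intr P = a *: \prod_i ('X - (z i)%:P).
Hypothesis zI : injective z.
Hypothesis a0 : a != 0.

Let Q : {poly rat} := map_poly intr P.
Let eQ : map_poly ratr Q = a *: \prod_i ('X - (z i)%:P).
Proof. by rewrite -eP -map_poly_comp; apply: eq_map_poly => k /=; rewrite rmorph_int. Qed.

Let a_rat : exists q : rat, a = ratr q.
Proof.
exists (lead_coef Q); rewrite -lead_coef_map eQ lead_coefZ.
by rewrite (monicP (monic_prod_XsubC _ _ _)) mulr1.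
Qed.

(** The i-th inner product is P'(z_i) / a. *)
Lemma rational_prod_diff_roots :
  exists q : rat, \prod_i \prod_(j | j != i) (z i - z j) = ratr q.
Proof.
have [q eq] := rational_prod_horner Q^`() zI eQ a0.
have [b eb] := a_rat.
exists (q / b ^+ n); rewrite fmorph_div rmorphXn /= -eb -eq.
apply: esym.
have -> : a ^+ n = \prod_(i < n) a by rewrite prodr_const card_ord.
rewrite -prodf_div; apply: eq_bigr => i _.
rewrite -deriv_map eQ derivZ hornerZ (bigD1 i) //= derivM hornerD !hornerM derivXsubC.
rewrite hornerC hornerXsubC subrr mul0r addr0 mul1r horner_prod mulrC mulKf //.
by apply: eq_bigr => j _; rewrite hornerXsubC.
Qed.

(** The i-th inner product is, up to sign, P(-z_i) / (2 a z_i). *)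
Lemma rational_prod_sum_roots : (forall i, z i != 0) ->
  exists q : rat, \prod_i \prod_(j | j != i) (z i + z j) = ratr q.
Proof.
move=> z0.
have [q eq] := rational_prod_horner (Q \Po - 'X) zI eQ a0.
have [r er] := rational_prod_horner ((-1) ^+ n *: 'X *+ 2) zI eQ a0.
have [b eb] := a_rat.
exists (q / (b ^+ n * r)); rewrite fmorph_div rmorphM rmorphXn /= -eb -eq -er.
have -> : a ^+ n = \prod_(i < n) a by rewrite prodr_const card_ord.
rewrite -big_split -prodf_div; apply: eq_bigr => i _ /=.
have -> : (map_poly ratr ((-1) ^+ n *: 'X *+ 2)).[z i] = (-1) ^+ n * (z i *+ 2).
  by rewrite rmorphMn /= linearZ /= map_polyX hornerMn hornerZ hornerX rmorphXn rmorphN1 mulrnAr.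
have -> : (map_poly ratr (Q \Po - 'X)).[z i] =
   a * ((-1) ^+ n * (z i *+ 2) * \prod_(j | j != i) (z i + z j)).
  rewrite map_comp_poly rmorphN /= map_polyX horner_comp hornerN hornerX eQ hornerZ horner_prod.
  congr (_ * _); under eq_bigr do rewrite hornerXsubC -opprD.
  by rewrite prodrN cardT size_enum_ord (bigD1 i) //= mulr2n mulrA.
have nz : a * ((-1) ^+ n * (z i *+ 2)) != 0.
  by rewrite !mulf_neq0 ?signr_eq0 ?mulrn_eq0 //=.
by rewrite [a * (_ * \prod_(j | _) _)]mulrA mulrAC mulfV // mul1r.
Qed.

(** The square of the number inside the norm is a nonzero integer: it is
    integral, and it is rational because both orders of each pair occur in it.
    The hypothesis says that no z_i + e z_j vanishes, except z_i - z_i when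
    e = -1. *)
Lemma lead_pairs_ge1 (b : bool) :
  (forall i j, z i + (-1) ^+ b * z j = 0 -> b && (i == j)) ->
  1 <= `|a ^+ n.-1 * \prod_(p : 'I_n * 'I_n | (p.1 < p.2)%N) (z p.1 + (-1) ^+ b * z p.2)|.
Proof.
move=> nz; set e := (-1) ^+ b; set E := _ * _.
have ie : integralOver (intr : int -> C) e.
  by rewrite /e; case: (b); [apply/integral_opp/integral1 | apply: integral1].
have ip i : integralOver (intr : int -> C) (a *: \prod_i ('X - (z i)%:P))`_i.
  by rewrite -eP coef_map; apply: integral_id.
have iE : integralOver (intr : int -> C) E by apply: integral_lead_pairs.
have E0 : E != 0.
  rewrite mulf_neq0 ?expf_neq0 //; apply/prodf_neq0 => -[i j] /= lt.
  by apply: contraTneq lt => /nz /andP[_ /eqP ->]; rewrite ltnn.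
have [q eq] : exists q : rat, \prod_i \prod_(j | j != i) (z i + e * z j) = ratr q.
  rewrite /e; case: (b) nz => nz.
    have [q eq] := rational_prod_diff_roots; exists q; rewrite -eq.
    by apply: eq_bigr => i _; apply: eq_bigr => j _; rewrite mulN1r.
  have z0 i : z i != 0 by apply/eqP => zi0; have := nz i i; rewrite zi0 mulr0 addr0 => /(_ erefl).
  have [q eq] := rational_prod_sum_roots z0; exists q; rewrite -eq.
  by apply: eq_bigr => i _; apply: eq_bigr => j _; rewrite mul1r.
have [c ec] := a_rat.
pose k := #|[pred p : 'I_n * 'I_n | (p.1 < p.2)%N]|.
have eE : E ^+ 2 = ratr (c ^+ n.-1 ^+ 2 * ((-1) ^+ b) ^+ k * q).
  rewrite !rmorphM /= !rmorphXn /= rmorphN1 -ec -eq -/e exprMn -mulrA; congr (_ * _).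
  rewrite (big_offdiag _ (fun i j => z i + e * z j)) -prodrXl.
  rewrite /k -prodr_const -big_split /=; apply: eq_bigr => -[i j] /= _.
  have ee : e * e = 1 by rewrite -expr2 sqrr_sign.
  by rewrite expr2; ring: ee.
have [|m em] := @integral_rational_int C (c ^+ n.-1 ^+ 2 * (-1) ^+ b ^+ k * q).
  by rewrite -eE; apply: integral_mul.
rewrite -(ler_pXn2r (n := 2)) ?nnegrE // expr1n -normrX eE em rmorph_int.
rewrite -intr_norm ler1z -gtz0_ge1 normr_gt0.
apply: contraNneq E0 => m0; rewrite -sqrf_eq0 eE em m0 rmorph0.
exact: eqxx.
Qed.
End Pairs.

(** * Landau's inequality for the Mahler measure *)

Section Landau.
Variable C : numClosedFieldType.

(** This is max(1, |z|); the order of C being partial, a maximum in C would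
    require comparability arguments. *)
Definition max1 (z : C) : C := if 1 <= `|z| then `|z| else 1.

Lemma max1_ge1 z : 1 <= max1 z.
Proof. by rewrite /max1; case: ifP. Qed.

Lemma max1_ge_norm z : `|z| <= max1 z.
Proof.
by rewrite /max1; case: ifP => // /negbT; rewrite -real_ltNge ?realE ?ler01 ?normr_ge0 // => /ltW.
Qed.

Lemma norm_add_le_max1 x y : `|x + y| <= 2 * (max1 x * max1 y).
Proof.
apply: le_trans (ler_normD _ _) _.
have hx := max1_ge1 x; have hy := max1_ge1 y.
have px := le_trans ler01 hx; have py := le_trans ler01 hy.
rewrite mulr_natl mulr2n; apply: lerD.
  by apply: le_trans (max1_ge_norm x) _; rewrite ler_peMr.
by apply: le_trans (max1_ge_norm y) _; rewrite ler_peMl.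
Qed.

Definition norm2 n (p : {poly C}) : C := \sum_(i < n) `|p`_i| ^+ 2.

(** The coefficients of the two products have square norms
    |p_(i-1)|^2 + |z|^2 |p_i|^2 and |p_i|^2 + |z|^2 |p_(i-1)|^2 up to the same
    cross term, so the difference telescopes. *)
Lemma norm2_flip n (p : {poly C}) z : (size p <= n)%N ->
  norm2 n.+1 (p * ('X - z%:P)) = norm2 n.+1 (p * (1 - z^* *: 'X)).
Proof.
move=> sp.
suff h m : norm2 m.+1 (p * ('X - z%:P)) + (1 - `|z| ^+ 2) * `|p`_m| ^+ 2 =
    norm2 m.+1 (p * (1 - z^* *: 'X)).
  by rewrite -h [p`_n]nth_default // normr0 expr0n mulr0 addr0.
rewrite /norm2; elim: m => [|m ih].
  rewrite !big_ord_recl !big_ord0 !addr0 mulrBr mulrBr mulr1 -scalerAr !coefB.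
  rewrite coefMX /= coefMC coefZ coefMX /= mulr0 subr0 sub0r normrN normrM; ring.
rewrite big_ord_recr /= [RHS]big_ord_recr /= -ih.
rewrite [p * ('X - _)]mulrBr [p * (1 - _)]mulrBr mulr1 -scalerAr !coefB.
rewrite coefMX /= coefMC coefZ coefMX /= !normCK !rmorphB !rmorphM /= conjCK.
ring.
Qed.

(** Each linear factor with a root z outside the unit disc is flipped into
    1 - z^* X, which keeps the norm and moves |z| into the leading
    coefficient of q. *)
Lemma landau_gen (rs : seq C) (q : {poly C}) n :
  (size q + size rs <= n)%N ->
  `|lead_coef q| ^+ 2 * \prod_(z <- rs) max1 z ^+ 2 <=
    norm2 n (q * \prod_(z <- rs) ('X - z%:P)).
Proof.
elim: rs q => [|z rs ih] q sn.
  rewrite !big_nil !mulr1 /norm2 addn0 in sn *.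
  have [->|q0] := eqVneq q 0.
    by rewrite lead_coef0 normr0 expr0n sumr_ge0 // => i _; rewrite exprn_ge0.
  have lt : ((size q).-1 < n)%N by rewrite prednK // size_poly_gt0.
  rewrite (bigD1 (Ordinal lt)) //= lead_coefE lerDl.
  by rewrite sumr_ge0 // => i _; rewrite exprn_ge0.
rewrite !big_cons /=; have [le|] := boolP (1 <= `|z|); last first.
  rewrite -real_ltNge ?realE ?ler01 ?normr_ge0 // => /ltW lt.
  have -> : max1 z = 1.
    by rewrite /max1; case: ifP => // le; apply/eqP; rewrite eq_le lt le.
  rewrite expr1n mul1r mulrA.
  have := ih (q * ('X - z%:P)); rewrite lead_coefM lead_coefXsubC mulr1; apply.
  have [->|q0] := eqVneq q 0; first by rewrite mul0r size_poly0; move: sn => /=; lia.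
  by rewrite size_Mmonic ?monicXsubC // size_XsubC addn2 /= -(addn1 (size q)); move: sn => /=; lia.
have ez : max1 z = `|z| by rewrite /max1 le.
have lz : lead_coef (1 - z^* *: 'X) = - z^*.
  have nz : z^* != 0 by rewrite conjC_eq0 -normr_gt0 (lt_le_trans ltr01).
  rewrite lead_coefDr ?lead_coefN ?lead_coefZ ?lead_coefX ?mulr1 //.
  by rewrite size_opp size_scale // size_polyX size_poly1.
have sz : (size (q * (1 - z^* *: 'X))%R <= (size q).+1)%N.
  apply: leq_trans (size_polyMleq _ _) _.
  have : (size (1 - z^* *: 'X)%R <= 2)%N.
    apply: leq_trans (size_polyD _ _) _; rewrite size_poly1 size_opp geq_max /=.
    by apply: leq_trans (size_scale_leq _ _) _; rewrite size_polyX.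
  by move: (size _) (size q) => k l; lia.
case: n ih sn => [|n] ih sn; first by move: sn => /=; lia.
have sq : (size (q * \prod_(z <- rs) ('X - z%:P))%R <= n)%N.
  apply: leq_trans (size_polyMleq _ _) _; rewrite size_prod_XsubC addnS.
  by move: sn => /=; lia.
rewrite [('X - _) * _]mulrC [q * _]mulrA norm2_flip // [q * _ * _]mulrAC.
have := ih (q * (1 - z^* *: 'X)).
rewrite lead_coefM lz normrM normrN norm_conjC exprMn => h.
rewrite ez [X in X <= _]mulrA; apply: h.
by move: sn sz => /=; move: (size _) (size q) (size rs) => i j k; lia.
Qed.

(** Landau's inequality: the Mahler measure is at most the l^2 norm. *)
Lemma landau (rs : seq C) a (P : {poly C}) : P = a *: \prod_(z <- rs) ('X - z%:P) ->
  (`|a| * \prod_(z <- rs) max1 z) ^+ 2 <= norm2 (size rs).+1 P.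
Proof.
move=> ->; rewrite exprMn -prodrXl.
have := @landau_gen rs a%:P (size rs).+1; rewrite lead_coefC mul_polyC; apply.
by rewrite -add1n leq_add2r size_polyC_leq1.
Qed.

End Landau.

(** * The lower bound *)

Lemma coef_le_height (P : {poly int}) i : (absz (P`_i)%R <= height P)%N.
Proof.
have [le|lt] := leqP (size P) i; first by rewrite nth_default.
exact: (leq_bigmax (F := fun j : 'I_(size P) => absz (P`_j)%R) (Ordinal lt)).
Qed.

Lemma norm2_le_height (C : numClosedFieldType) n (P : {poly int}) :
  norm2 n (map_poly intr P : {poly C}) <= n%:R * (height P)%:R ^+ 2.
Proof.
apply: (@le_trans _ _ (\sum_(i < n) (height P)%:R ^+ 2)); last first.
  by rewrite sumr_const card_ord mulr_natl.
apply: ler_sum => i _; rewrite coef_map /= -intr_norm -abszE.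
by rewrite lerXn2r ?nnegrE ?ler0n // ler_nat coef_le_height.
Qed.

(** The inequality 2 <= |x + e y| 2^(d(d-1)/2) M^(d-1), squared so that M is
    replaced with its bound sqrt(d+1) H(P) without square roots. *)
Lemma root_pair_bound (C : numClosedFieldType) (P : {poly int}) (a x y : C) s (b : bool) :
  let rs := [:: x, y & s] in let d := size rs in
  map_poly intr P = a *: \prod_(z <- rs) ('X - z%:P) -> a != 0 -> uniq rs ->
  {in rs &, forall u v, u + (-1) ^+ b * v = 0 -> b && (u == v)} ->
  4 <= `|x + (-1) ^+ b * y| ^+ 2 * 2 ^+ (d * d.-1) * (d.+1%:R * (height P)%:R ^+ 2) ^+ d.-1.
Proof.
move=> rs d eP a0 urs nz.
pose z (i : 'I_d) := nth 0 rs i.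
have zI : injective z.
  by move=> i j /eqP; rewrite /z nth_uniq // => /eqP/ord_inj.
have zin i : z i \in rs by rewrite mem_nth.
have prodz (F : C -> {poly C}) : \prod_(u <- rs) F u = \prod_i F (z i).
  by rewrite (big_nth 0) big_mkord.
have prodzC (F : C -> C) : \prod_(u <- rs) F u = \prod_i F (z i).
  by rewrite (big_nth 0) big_mkord.
have eP' : map_poly intr P = a *: \prod_i ('X - (z i)%:P) by rewrite eP prodz.
set e := (-1) ^+ b in nz *.
have ge1 : 1 <= `|a ^+ d.-1 * \prod_(p : 'I_d * 'I_d | (p.1 < p.2)%N) (z p.1 + e * z p.2)|.
  apply: (@lead_pairs_ge1 _ _ _ P) => // i j /(nz _ _ (zin i) (zin j)).
  by rewrite (inj_eq zI).
set M := `|a| * \prod_(u <- rs) max1 u.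
have M0 : 0 <= M.
  by rewrite mulr_ge0 ?normr_ge0 // prodr_ge0 // => u _; apply: le_trans (max1_ge1 u).
have M2 : M ^+ 2 <= d.+1%:R * (height P)%:R ^+ 2.
  exact: le_trans (landau eP) (norm2_le_height _ _ _).
pose p0 : 'I_d * 'I_d := (ord0, inord 1).
pose k := #|[pred p : 'I_d * 'I_d | (p.1 < p.2)%N]|.
have ek : (k * 2 = d * d.-1)%N.
  rewrite /k -sum1_card big_distrl /= (eq_bigr (fun=> 1 + 1)%N) //.
  rewrite -(big_offdiag _ (fun _ _ : 'I_d => 1%N)).
  under eq_bigr do rewrite sum1_card cardC1 card_ord.
  by rewrite sum_nat_const card_ord.
have main : 2 <= `|x + e * y| * 2 ^+ k * M ^+ d.-1.
  pose m p : C := 2 * (max1 (z p.1) * max1 (z p.2)).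
  have all : \prod_(p : 'I_d * 'I_d | (p.1 < p.2)%N) m p = 2 ^+ k * \prod_i max1 (z i) ^+ d.-1.
    rewrite /m big_split /= prodr_const; congr (_ * _).
    rewrite -(big_offdiag _ (fun i _ => max1 (z i))).
    by apply: eq_bigr => i _; rewrite prodr_const cardC1 card_ord.
  have lt0 : (p0.1 < p0.2)%N by rewrite /= inordK.
  have e0 : z p0.1 = x /\ z p0.2 = y by rewrite /z /= inordK.
  (* The omitted factor is still counted in the product of the bounds; as its
     bound is at least 2, it is traded for the constant 2 on the left. *)
  have m0 : 2 <= m p0.
    rewrite /m ler_peMr ?ler0n //; apply: le_trans (max1_ge1 (z p0.1)) _.
    by rewrite ler_peMr ?max1_ge1 //; apply: le_trans (max1_ge1 _).
  have -> : `|x + e * y| * 2 ^+ k * M ^+ d.-1 =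
     `|a| ^+ d.-1 * `|x + e * y| * \prod_(p : 'I_d * 'I_d | (p.1 < p.2)%N) m p.
    by rewrite all /M prodzC exprMn prodrXl; ring.
  rewrite (bigD1 p0) //= mulrA -[X in X <= _]mul1r.
  move: ge1; rewrite normrM normrX normr_prod (bigD1 p0) //=.
  case: e0 => -> -> ge1.
  set T := \prod_(p | _) m p.
  have T1 : 1 <= `|a| ^+ d.-1 * `|x + e * y| * T.
    apply: le_trans ge1 _; rewrite -mulrA; do 2 rewrite ler_wpM2l ?exprn_ge0 //.
    apply: ler_prod => p _; rewrite normr_ge0 /=.
    apply: le_trans (norm_add_le_max1 _ _) _.
    by rewrite /m {2}/max1 normrM normrX normrN1 expr1n mul1r.
  rewrite [_ * m p0]mulrC -mulrA -[X in X <= _]mulrC.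
  by apply: ler_pM.
have : 2 ^+ 2 <= (`|x + e * y| * 2 ^+ k * M ^+ d.-1) ^+ 2.
  by rewrite lerXn2r ?nnegrE ?ler0n //; apply: le_trans main; rewrite ler0n.
have -> : (`|x + e * y| * 2 ^+ k * M ^+ d.-1) ^+ 2 =
    `|x + e * y| ^+ 2 * 2 ^+ (d * d.-1) * (M ^+ 2) ^+ d.-1.
  by rewrite 2!exprMn -!exprM ek [(2 * _)%N]mulnC.
rewrite -natrX => h; apply: le_trans h _.
rewrite ler_wpM2l ?mulr_ge0 ?exprn_ge0 //.
by rewrite lerXn2r ?nnegrE ?exprn_ge0 // mulr_ge0 ?exprn_ge0.
Qed.

Local Open Scope complex_scope.

Lemma height_gt0 (P : {poly int}) : P != 0 -> (0 < height P)%N.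
Proof.
move=> P0; apply: leq_trans (coef_le_height P (size P).-1).
by rewrite absz_gt0 -lead_coefE lead_coef_eq0.
Qed.

Lemma nonuniq_sqr_dvdp (F : fieldType) (rs : seq F) : ~~ uniq rs ->
  exists z, ('X - z%:P) ^+ 2 %| \prod_(u <- rs) ('X - u%:P).
Proof.
elim: rs => //= x rs ih; rewrite negb_and negbK big_cons => /orP[xin|/ih [z dz]].
  by exists x; rewrite expr2 dvdp_mul // dvdp_XsubCl root_prod_XsubC.
by exists z; rewrite dvdp_mull.
Qed.

Lemma dist_norm_signed (R : realDomainType) (x y : R) :
  exists b : bool, `| `|x| - `|y| | = `|x + (-1) ^+ b * y|.
Proof.
have [x0|x0] := ger0P x; have [y0|y0] := ger0P y.
- by exists true; rewrite expr1 mulN1r.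
- by exists false; rewrite mul1r opprK.
- by exists false; rewrite mul1r -opprD normrN.
by exists true; rewrite expr1 mulN1r opprK -normrN opprD opprK.
Qed.

(** Passing from natural to real exponents; since d (d - 1) <= d^2, the
    power of 2 in the conclusion is weaker than the one in the hypothesis. *)
Lemma bound_of_square (R : realType) d h (x : R) : (2 <= d)%N -> (0 < h)%N -> 0 <= x ->
  4 <= x ^+ 2 * 2 ^+ (d * d.-1) * (d.+1%:R * h%:R ^+ 2) ^+ d.-1 ->
  2 `^ ((- d%:R ^+ 2 + 2) / 2) * (d%:R + 1) `^ ((- d%:R + 1) / 2)
       * h%:R `^ (- d%:R + 1) <= x.
Proof.
move=> d2 h0 x0 hx; set L := (X in X <= _).
have L0 : 0 <= L by rewrite /L !mulr_ge0 ?powR_ge0.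
rewrite -(ler_pXn2r (n := 2)) ?nnegrE //.
have hp : (0 : R) < h%:R by rewrite ltr0n.
pose B : R := 2 ^+ (d * d - 2) * (d.+1%:R * h%:R ^+ 2) ^+ d.-1.
have B0 : 0 < B by rewrite !mulr_gt0 ?exprn_gt0 ?mulr_gt0 ?exprn_gt0 ?ltr0n.
rewrite -(ler_pM2r B0).
have -> : L ^+ 2 * B = 1.
  have sq (y z : R) : (y `^ z) ^+ 2 = y `^ (z * 2).
    by rewrite powRrM -powR_mulrn ?powR_ge0.
  have e1 : (- d%:R ^+ 2 + 2 : R) = - (d * d - 2)%:R.
    by rewrite natrB ?natrM; [ring | nia].
  have e2 : (- d%:R + 1 : R) = - d.-1%:R.
    by rewrite -subn1 natrB; [ring | lia].
  rewrite /L !exprMn !sq !divfK ?pnatr_eq0 // e1 e2 mulNr -natrM natr1.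
  rewrite !powR_invn ?ler0n // /B exprMn -exprM [(2 * _)%N]mulnC.
  set u := _ ^+ (d * d - 2); set v := _ ^+ d.-1; set w := _ ^+ (d.-1 * 2).
  have u0 : u != 0 by rewrite expf_neq0 ?pnatr_eq0.
  have v0 : v != 0 by rewrite expf_neq0 ?pnatr_eq0.
  have w0 : w != 0 by apply: expf_neq0; rewrite pnatr_eq0 -lt0n.
  by field; rewrite u0 v0 w0.
apply: (@le_trans _ _ (4^-1 * (x ^+ 2 * 2 ^+ (d * d.-1) * (d.+1%:R * h%:R ^+ 2) ^+ d.-1))).
  by rewrite ler_pdivlMl ?mulr1 // ltr0n.
rewrite ler_pdivrMl ?ltr0n // /B; set w := _ ^+ d.-1.
have w0 : 0 <= w by rewrite exprn_ge0 // mulr_ge0 ?exprn_ge0.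
set u := 2 ^+ (d * d - 2); have -> : 4 * (x ^+ 2 * (u * w)) = x ^+ 2 * (4 * u) * w by ring.
rewrite ler_wpM2r // ler_wpM2l ?exprn_ge0 // /u.
have -> : 4 = 2 ^+ 2 :> R by rewrite -natrX.
by rewrite -exprD ler_eXn2l ?ltr1n //; nia.
Qed.

Lemma abs_separation_lower_bound (R : realType) (d : nat) (P : {poly int}) (alpha beta : R) (s : seq R[i]) :
     (2 <= d)%N ->
     size P = d.+1 ->
     no_multiple_root R P ->
     complex_poly R P =
       lead_coef (complex_poly R P)
         *: \prod_(z <- [:: alpha%:C, beta%:C & s]) ('X - z%:P) ->
     {in [:: alpha%:C, beta%:C & s] &, forall z w : R[i], z + w != 0} ->
     2 `^ ((- d%:R ^+ 2 + 2) / 2) * (d%:R + 1) `^ ((- d%:R + 1) / 2)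
       * (height P)%:R `^ (- d%:R + 1)
     <= `| `|alpha| - `|beta| |.
Proof.
move=> d2 sP nmr eP sum0.
set rs := [:: _, _ & s] in eP sum0; set a := lead_coef _ in eP.
have P0 : P != 0 by rewrite -size_poly_eq0 sP.
have sC : size (complex_poly R P) = d.+1.
  rewrite /complex_poly -sP size_map_inj_poly //; exact: intr_inj.
have a0 : a != 0 by rewrite lead_coef_eq0 -size_poly_eq0 sC.
have srs : size rs = d.
  by move: sC; rewrite eP size_scale // size_prod_XsubC => -[].
have urs : uniq rs.
  apply: contraT => /nonuniq_sqr_dvdp [z dz]; have /negP := nmr z; case.
  by rewrite eP dvdpZr.
apply: bound_of_square => //; first exact: height_gt0.
have [b eb] := dist_norm_signed alpha beta.
have := @root_pair_bound _ P a alpha%:C beta%:C s b eP a0 urs.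
rewrite -/rs srs eb => h.
rewrite -lecR rmorphM /= !rmorphM /= !rmorphXn /= rmorphM /= rmorphXn !rmorph_nat.
have -> : `|alpha + (-1) ^+ b * beta|%:C = `|alpha%:C + (-1) ^+ b * beta%:C|.
  have <- : (alpha + (-1) ^+ b * beta)%:C = alpha%:C + (-1) ^+ b * beta%:C.
    by rewrite rmorphD rmorphM rmorph_sign.
  by rewrite normc_def /= expr0n addr0 sqrtr_sqr.
apply: h => u v uin vin; case: b {eb} => /=; last first.
  by rewrite mul1r => e; have := sum0 _ _ uin vin; rewrite e eqxx.
by rewrite mulN1r => /eqP; rewrite subr_eq0.
Qed.

(** * Polynomials with two almost opposite real roots *)

(** With r = 1 - 1/n, the first term vanishes at r and the second one at -r,
    and each is of order n^(1-k) at the zero of the other. *)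
Definition twin_poly (S : comNzRingType) (k A n : nat) : {poly S} :=
  A%:R * (1 + 'X) ^+ k * (n%:R * 'X - (n%:R - 1))
  + (1 - 'X) ^+ k * (n%:R * 'X + (n%:R - 1)).

Lemma map_twin_poly (S S' : comNzRingType) (f : {rmorphism S -> S'}) k A n :
  map_poly f (twin_poly S k A n) = twin_poly S' k A n.
Proof.
by rewrite /twin_poly !(rmorphD, rmorphN, rmorphM, rmorphXn, rmorph_nat, rmorph1) /= map_polyX.
Qed.

Lemma horner_twin_poly (S : comNzRingType) k A n (x : S) :
  (twin_poly S k A n).[x] = A%:R * (1 + x) ^+ k * (n%:R * x - (n%:R - 1))
  + (1 - x) ^+ k * (n%:R * x + (n%:R - 1)).
Proof. by rewrite /twin_poly -!polyC_natr !hornerE. Qed.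

Lemma horner_deriv_twin_poly (S : comNzRingType) k A n (x : S) :
  (twin_poly S k.+1 A n)^`().[x] =
  A%:R * (1 + x) ^+ k * ((1 + x) * n%:R + k.+1%:R * (n%:R * x - (n%:R - 1)))
  + (1 - x) ^+ k * ((1 - x) * n%:R - k.+1%:R * (n%:R * x + (n%:R - 1))).
Proof.
rewrite /twin_poly -!polyC_natr !derivE !hornerE /= !deriv_exp !derivE !hornerE /= !hornerMn !hornerE.
rewrite ?mulN1r ?mulNrn -(mulr_natr ((1 + x) ^+ k)) -(mulr_natr ((1 - x) ^+ k)) !exprS.
ring.
Qed.

(** The coefficient of X^(k+1) is (A + (-1)^k) n, and A > 1. *)
Lemma size_twin_poly k A n : (1 < A)%N -> (0 < n)%N -> size (twin_poly int k A n) = k.+2.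
Proof.
move=> A1 n0.
have e1 : twin_poly int k A n =
  A%:R *: ('X - (-1)%:P) ^+ k * (n%:R *: 'X + (1 - n%:R)%:P) +
  (-1) ^+ k *: ('X - 1%:P) ^+ k * (n%:R *: 'X + (n%:R - 1)%:P).
  rewrite /twin_poly -!mul_polyC polyCN polyC1 opprK !polyCB polyC1 !polyC_natr.
  by rewrite polyC_exp polyCN -exprMn mulN1r [- ('X - 1)]opprB [1 + 'X]addrC [- (_ - 1)]opprB.
have lo (p : {poly int}) (b c : int) : (size p <= k.+1)%N ->
    (size (p * (b *: 'X + c%:P))%R <= k.+2)%N /\ (p * (b *: 'X + c%:P))`_k.+1 = p`_k * b.
  move=> sp; split.
    apply: leq_trans (size_polyMleq _ _) _.
    have : (size (b *: 'X + c%:P)%R <= 2)%N.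
      apply: leq_trans (size_polyD _ _) _; rewrite geq_max; apply/andP; split.
        by apply: leq_trans (size_scale_leq _ _) _; rewrite size_polyX.
      by apply: leq_trans (size_polyC_leq1 _) _.
    by move: (size _) (size p) sp => i j; lia.
  rewrite mulrDr -scalerAr coefD coefZ coefMX coefMC /= [p`_k.+1]nth_default //.
  by rewrite mul0r addr0 mulrC.
have s1 (u c : int) : (size (u *: ('X - c%:P) ^+ k)%R <= k.+1)%N /\
    (u *: ('X - c%:P) ^+ k)`_k = u.
  split; first by apply: leq_trans (size_scale_leq _ _) _; rewrite size_exp_XsubC.
  rewrite coefZ; have := monicP (monic_exp k (monicXsubC c)).
  by rewrite lead_coefE size_exp_XsubC /= => ->; rewrite mulr1.
have [sa ca] := s1 A%:R (-1); have [sb cb] := s1 ((-1) ^+ k) 1.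
have [] := lo _ n%:R (1 - n%:R) sa; have [] := lo _ n%:R (n%:R - 1) sb.
rewrite ca cb => sy cy sx cx.
apply/eqP; rewrite e1 eqn_leq; apply/andP; split.
  by apply: leq_trans (size_polyD _ _) _; rewrite geq_max sx sy.
rewrite ltnNge; apply/negP => /leq_sizeP/(_ k.+1 (leqnn _))/eqP; apply/negP.
rewrite coefD cx cy -mulrDl mulf_neq0 //; last by rewrite pnatr_eq0 -lt0n.
by rewrite -signr_odd; case: odd; rewrite ?expr1 ?expr0; lia.
Qed.

(** Below, X and Y are the values at z of the two terms of a twin polynomial,
    without the factor A; changing z into -z maps (X, Y) to (-Y, -X). *)
Section TwinRoots.
Variable C : numFieldType.
Implicit Types (z : C) (k A B n : nat).

(** The zeros -1, r of the first term and 1, -r of the second one are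
    distinct. *)
Lemma twin_terms_neq0 k n z : (0 < k)%N -> (1 < n)%N ->
  (1 + z) ^+ k * (n%:R * z - (n%:R - 1)) = 0 ->
  (1 - z) ^+ k * (n%:R * z + (n%:R - 1)) = 0 -> False.
Proof.
move=> k0 n1 /eqP; rewrite mulf_eq0 expf_eq0 k0 /= => hx /eqP.
rewrite mulf_eq0 expf_eq0 k0 /= => hy.
have np : (0 : C) < n%:R - 1 by rewrite subr_gt0 ltr1n.
have n0 : (0 : C) < n%:R by rewrite ltr0n; lia.
case/orP: hx => /eqP hx; case/orP: hy => /eqP hy.
- have : (2 : C) = 0.
    have -> : (2 : C) = (1 + z) + (1 - z) by ring.
    by rewrite hx hy addr0.
  by move/eqP; rewrite pnatr_eq0.
- have : (1 : C) = 0.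
    have -> : (1 : C) = n%:R * (1 + z) - (n%:R * z + (n%:R - 1)) by ring.
    by rewrite hx hy mulr0 subr0.
  by move/eqP; rewrite oner_eq0.
- have : (1 : C) = 0.
    have -> : (1 : C) = n%:R * (1 - z) + (n%:R * z - (n%:R - 1)) by ring.
    by rewrite hx hy mulr0 addr0.
  by move/eqP; rewrite oner_eq0.
have : (n%:R - 1) *+ 2 = 0 :> C.
  have -> : (n%:R - 1) *+ 2 = (n%:R * z + (n%:R - 1)) - (n%:R * z - (n%:R - 1)) by ring.
  by rewrite hx hy subrr.
by move/eqP; rewrite mulrn_eq0 /= gt_eqF.
Qed.

(** The equations A X + Y = 0 and X + B Y = 0 force X = Y = 0. For A = B this
    says that no two roots of a twin polynomial have sum 0. *)
Lemma twin_root_opp k A B n z : (0 < k)%N -> (1 < n)%N -> (1 < A * B)%N ->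
  root (twin_poly C k A n) z -> root (twin_poly C k B n) (- z) -> False.
Proof.
move=> k0 n1 AB /rootP; rewrite horner_twin_poly => h1 /rootP; rewrite horner_twin_poly.
rewrite mulrN opprK -!mulrA in h1 *.
set X := (1 + z) ^+ k * (n%:R * z - (n%:R - 1)) in h1.
set Y := (1 - z) ^+ k * (n%:R * z + (n%:R - 1)) in h1.
move=> h2.
have {}h2 : B%:R * Y + X = 0 by rewrite -[RHS]oppr0 -h2 /X /Y; ring.
have Y0 : Y = 0.
  have : ((A * B)%:R - 1) * Y = 0.
    have -> : ((A * B)%:R - 1) * Y = A%:R * (B%:R * Y + X) - (A%:R * X + Y).
      by rewrite natrM; ring.
    by rewrite h1 h2 mulr0 subrr.
  by move/eqP; rewrite mulf_eq0 subr_eq0 pnatr_eq1 gtn_eqF //= => /eqP.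
have X0 : X = 0 by move: h2; rewrite Y0 mulr0 add0r.
exact: twin_terms_neq0 X0 Y0.
Qed.

Lemma twin_root_common k A B n z : (0 < k)%N -> (1 < n)%N -> A != B ->
  root (twin_poly C k A n) z -> root (twin_poly C k B n) z -> False.
Proof.
move=> k0 n1 AB /rootP; rewrite horner_twin_poly => h1 /rootP; rewrite horner_twin_poly.
rewrite -!mulrA in h1 *.
set X := (1 + z) ^+ k * (n%:R * z - (n%:R - 1)) in h1 *.
set Y := (1 - z) ^+ k * (n%:R * z + (n%:R - 1)) in h1 *.
move=> h2.
have X0 : X = 0.
  have : (A%:R - B%:R) * X = 0.
    have -> : (A%:R - B%:R) * X = (A%:R * X + Y) - (B%:R * X + Y) by ring.
    by rewrite h1 h2 subrr.
  by move/eqP; rewrite mulf_eq0 subr_eq0 eqr_nat (negPf AB) => /eqP.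
have Y0 : Y = 0 by move: h2; rewrite X0 mulr0 add0r.
exact: twin_terms_neq0 X0 Y0.
Qed.

(** A double root makes the Wronskian of the two terms vanish. The powers of
    1 + z and 1 - z factor out, and the remaining quadratic equation in z
    does not involve A. *)
Lemma twin_double_root k A n z : (1 < n)%N -> (0 < A)%N ->
  root (twin_poly C k.+1 A n) z -> root (twin_poly C k.+1 A n)^`() z ->
  z ^+ 2 * (n%:R * (n%:R - 1) - k.+1%:R * n%:R ^+ 2) =
  n%:R * (n%:R - 1) - k.+1%:R * (n%:R - 1) ^+ 2.
Proof.
move=> n1 A0 /rootP; rewrite horner_twin_poly => h1 /rootP; rewrite horner_deriv_twin_poly => h2.
have A0' : A%:R != 0 :> C by rewrite pnatr_eq0 -lt0n.
have two0 : (2 : C) != 0 by rewrite pnatr_eq0.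
have zp : 1 + z != 0.
  apply: contra_eqN h1 => /eqP e; have -> : z = -1 by apply/eqP; rewrite -addr_eq0 addrC e.
  rewrite subrr expr0n /= mulr0 mul0r add0r opprK mulf_neq0 ?expf_neq0 //.
  by rewrite mulrN1 addrA addNr add0r oppr_eq0 oner_eq0.
have zm : 1 - z != 0.
  apply: contra_eqN h1; rewrite subr_eq0 => /eqP <-.
  rewrite subrr expr0n /= mul0r addr0 !mulf_neq0 ?expf_neq0 //.
  by rewrite mulr1 opprB addrCA subrr addr0 oner_eq0.
set p := (1 + z) ^+ k in h2; set q := (1 - z) ^+ k in h2.
have q0 : q != 0 by rewrite expf_neq0.
have {}h1 : A%:R * p * ((1 + z) * (n%:R * z - (n%:R - 1))) + q * ((1 - z) * (n%:R * z + (n%:R - 1))) = 0.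
  by rewrite -[RHS]h1 !exprS -/p -/q; ring.
set a := (1 + z) * _ in h1; set b := (1 - z) * _ in h1.
set a' := _ + _ * _ in h2; set b' := (1 - z) * _ - _ in h2.
have : q * (a * b' - a' * b) = 0.
  have -> : q * (a * b' - a' * b) =
     a * (A%:R * p * a' + q * b') - a' * (A%:R * p * a + q * b) by ring.
  by rewrite h1 h2 !mulr0 subrr.
move/eqP; rewrite mulf_eq0 (negPf q0) /= => /eqP h.
apply/eqP; rewrite -subr_eq0; apply/eqP/(mulfI two0); rewrite mulr0 -[RHS]h.
by rewrite /a /b /a' /b'; ring.
Qed.

End TwinRoots.

Lemma height_natD (U V : {poly int}) n : (0 < n)%N ->
  (height (n%:R * U + V) <= (height U + height V) * n)%N.
Proof.
move=> n0; apply/bigmax_leqP => -[i _] _ /=.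
have := coef_le_height U i; have := coef_le_height V i.
rewrite coefD -polyC_natr coefCM natz => hV hU.
apply: (@leq_trans (n * absz (U`_i)%R + absz (V`_i)%R)).
  have := abszM n%:Z (U`_i)%R; rewrite absz_nat => <-; move: (n%:Z * _)%R (V`_i)%R => {hU hV} m v; lia.
by nia.
Qed.

Definition quad_poly (S : comNzRingType) (n : nat) : {poly S} := n%:R * ('X ^+ 2 - 1) + 'X.

Section IVT.
Variable R : rcfType.

(** Write q = 1/n and let d be the claimed bound. The polynomial is nonnegative
    at 1 - q and nonpositive at 1 - q - d, because the term that vanishes at
    1 - q dominates there: it has size at least n d, and the other term has
    size at most (q + d)^k 2 n <= (2 q)^k 2 n. The same comparison, with a
    factor A <= 3 on the small term, applies at q - 1 and q - 1 + d. Here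
    k >= 2 ensures d <= q. *)
Lemma twin_close_roots k A n : (2 <= k)%N -> (2 <= A <= 3)%N -> (3 * 2 ^ k.+1 <= n)%N ->
  exists x y : R, [/\ root (twin_poly R k A n) x, root (twin_poly R k A n) y,
    0 < x, y < 0 & `|x + y| <= (3 * 2 ^ k.+1)%:R / n%:R ^+ k].
Proof.
set K := (3 * 2 ^ k.+1)%N => k2 /andP[A2 A3] Kn.
have K4 : (4 <= K)%N by rewrite /K -(subnK k2) !addnS !expnS; have := expn_gt0 2 (k - 2 + 0); lia.
have n0 : (0 : R) < n%:R by rewrite ltr0n; lia.
have eK : K%:R = 3 * 2 ^+ k.+1 :> R by rewrite natrM natrX.
set d := K%:R / n%:R ^+ k.
have nd : n%:R * d <= 1.
  rewrite /d mulrA ler_pdivrMr ?exprn_gt0 // mul1r -(subnK k2) addn2 !exprS.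
  rewrite ler_pM2l // -[X in X <= _]mulr1.
  by rewrite ler_pM ?ler0n ?ler_nat // exprn_ege1 // ler1n; lia.
have d0 : 0 <= d by rewrite divr_ge0 ?ler0n ?exprn_ge0.
pose q : R := n%:R^-1.
have nq : n%:R * q = 1 by rewrite mulfV ?gt_eqF.
have q0 : 0 < q by rewrite invr_gt0.
have q1 : q <= 4^-1.
  by rewrite lef_pV2 ?posrE ?ler_nat //; lia.
have dq : d <= q by rewrite -(ler_pM2l n0) nq.
have nl : (1 : R) <= n%:R by rewrite ler1n; lia.
have main : 3 * ((q + d) ^+ k * (2 * n%:R)) <= n%:R * d.
  apply: (@le_trans _ _ (3 * ((2 * q) ^+ k * (2 * n%:R)))).
    rewrite ler_pM2l ?ltr0n // ler_pM2r ?mulr_gt0 ?ltr0n //; last lia.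
    by rewrite lerXn2r ?nnegrE; lra.
  rewrite /d eK exprS exprMn /q exprVn.
  by rewrite le_eqVlt; apply/orP; left; apply/eqP; ring.
have pk : 0 <= (q + d) ^+ k by rewrite exprn_ge0 //; lra.
have t1 : 1 <= (2 - (q + d)) ^+ k by rewrite exprn_ege1 //; lra.
have Ar2 : (2 : R) <= A%:R by rewrite ler_nat.
have Ar3 : (A%:R : R) <= 3 by rewrite ler_nat.
set w := n%:R * d in main nd.
have w0 : 0 <= w by rewrite mulr_ge0 // ltW.
set t := (2 - (q + d)) ^+ k in t1.
set u := (q + d) ^+ k in main pk.
have un : 0 <= u * (2 * n%:R) by rewrite mulr_ge0 // mulr_ge0 // ltW.
have qk0 : 0 <= q ^+ k by rewrite exprn_ge0 // ltW.
have wt : w <= t * w by rewrite ler_peMl.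
have [x /andP[x1 x2] rx] : exists2 x, 1 - q - d <= x <= 1 - q & root (twin_poly R k A n) x.
  apply: poly_ivt; first by lra.
  apply/andP; split; rewrite horner_twin_poly.
    have -> : 1 + (1 - q - d) = 2 - (q + d) by ring.
    have -> : 1 - (1 - q - d) = q + d by ring.
    rewrite -/t -/u.
    have -> : n%:R * (1 - q - d) - (n%:R - 1) = - w - (n%:R * q - 1) by rewrite /w; ring.
    have -> : n%:R * (1 - q - d) + (n%:R - 1) = 2 * n%:R - 1 - w - n%:R * q by rewrite /w; ring.
    rewrite nq subrr subr0.
    have wA : t * w <= A%:R * t * w by rewrite -mulrA ler_peMl; lra.
    have uw : 0 <= u * w by rewrite mulr_ge0.
    by lra.
  have -> : n%:R * (1 - q) - (n%:R - 1) = 1 - n%:R * q by ring.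
  rewrite nq subrr mulr0 add0r subKr mulr_ge0 //.
  have -> : n%:R * (1 - q) + (n%:R - 1) = 2 * n%:R - 1 - n%:R * q by ring.
  by rewrite nq; lra.
have [y /andP[y1 y2] ry] : exists2 x, q - 1 <= x <= q - 1 + d & root (twin_poly R k A n) x.
  apply: poly_ivt; first by lra.
  apply/andP; split; rewrite horner_twin_poly.
    have -> : n%:R * (q - 1) + (n%:R - 1) = n%:R * q - 1 by ring.
    have -> : n%:R * (q - 1) - (n%:R - 1) = n%:R * q + 1 - 2 * n%:R by ring.
    rewrite nq subrr mulr0 addr0 addrC subrK mulr_ge0_le0 ?mulr_ge0 //; lra.
  have -> : 1 + (q - 1 + d) = q + d by ring.
  have -> : 1 - (q - 1 + d) = 2 - (q + d) by ring.
  rewrite -/t -/u.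
  have -> : n%:R * (q - 1 + d) - (n%:R - 1) = w + n%:R * q + 1 - 2 * n%:R by rewrite /w; ring.
  have -> : n%:R * (q - 1 + d) + (n%:R - 1) = w + (n%:R * q - 1) by rewrite /w; ring.
  rewrite nq subrr addr0.
  have uA : A%:R * (u * (2 * n%:R)) <= 3 * (u * (2 * n%:R)) by rewrite ler_wpM2r.
  have uw : 0 <= A%:R * u * (w + 2) by rewrite !mulr_ge0 // addr_ge0.
  by lra.
exists x, y; split => //; [lra|lra|].
by rewrite ler_norml; apply/andP; split; lra.
Qed.

(** The sum of the two roots is -1/n. *)
Lemma quad_close_roots n : (2 <= n)%N ->
  exists x y : R, [/\ root (quad_poly R n) x, root (quad_poly R n) y,
    0 < x, y < 0 & `|x + y| <= n%:R^-1].
Proof.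
move=> n2.
have n0 : (0 : R) < n%:R by rewrite ltr0n; lia.
have hq x : (quad_poly R n).[x] = n%:R * (x ^+ 2 - 1) + x.
  by rewrite /quad_poly -!polyC_natr !hornerE.
have [x /andP[x0 x1] rx] : exists2 x, 0 <= x <= 1 & root (quad_poly R n) x.
  apply: poly_ivt; rewrite ?ler01 // !hq expr0n expr1n /=; lra.
have hx := rootP rx; rewrite hq in hx.
have xp : x != 0 by apply: contra_eqN hx => /eqP ->; rewrite expr0n /=; lra.
have xp' : 0 < x by rewrite lt0r xp.
exists x, (- n%:R^-1 - x).
have nq : n%:R * n%:R^-1 = 1 :> R by rewrite mulfV ?gt_eqF.
have q0 : (0 : R) < n%:R^-1 by rewrite invr_gt0.
split => //; last by rewrite addrCA subrr addr0 normrN ger0_norm // ltW.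
- apply/rootP; rewrite hq -[RHS]hx.
  have -> : n%:R * ((- n%:R^-1 - x) ^+ 2 - 1) = n%:R * n%:R^-1 * (n%:R^-1 + 2 * x) + n%:R * (x ^+ 2 - 1) by ring.
  by rewrite nq; ring.
- lra.
Qed.
End IVT.

(** * Sharpness of the exponent *)

Lemma double_root_deriv (F : fieldType) (p : {poly F}) z :
  ('X - z%:P) ^+ 2 %| p -> root p z /\ root p^`() z.
Proof.
case/dvdpP => q ->; have := hornerXsubC z z; have := derivXsubC z.
rewrite subrr; move: ('X - z%:P) => l dl lz; split; apply/rootP.
  by rewrite expr2 !hornerM lz !mulr0.
by rewrite expr2 !derivM dl mulr1 mul1r hornerD !hornerM hornerD lz !(mulr0, addr0).
Qed.

Lemma root_complex_poly (R : realType) (P : {poly int}) (x : R) :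
  root (map_poly intr P) x -> root (complex_poly R P) x%:C.
Proof.
rewrite -(fmorph_root (real_complex R)) -map_poly_comp /complex_poly.
by rewrite (eq_map_poly (g := intr)) // => k /=; rewrite rmorph_int.
Qed.

Definition close_twin_roots (R : realType) k (e : R) (P : {poly int}) :=
  [/\ size P = k.+2, no_multiple_root R P,
      (forall z w : R[i], root (complex_poly R P) z ->
         root (complex_poly R P) w -> z + w != 0)
    & exists x y : R, [/\ root (complex_poly R P) x%:C, root (complex_poly R P) y%:C,
         0 < x, y < 0 & `|x + y| <= e]].

Lemma quad_family (R : realType) n : (2 <= n)%N ->
  close_twin_roots 1 (n%:R^-1 : R) (quad_poly int n).
Proof.
move=> n2.
have mapq (S : comNzRingType) : map_poly intr (quad_poly int n) = quad_poly S n.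
  by rewrite /quad_poly rmorphD rmorphM rmorphB rmorphXn rmorph_nat rmorph1 /= map_polyX.
have hq (z : R[i]) : (complex_poly R (quad_poly int n)).[z] = n%:R * (z ^+ 2 - 1) + z.
  by rewrite /complex_poly mapq /quad_poly -!polyC_natr !hornerE.
have n0 : n%:R != 0 :> R[i] by rewrite pnatr_eq0; lia.
split.
- have s3 : size ('X ^+ 2 - 1 : {poly int}) = 3 by rewrite -polyC1 size_XnsubC.
  have s3' : size (n%:R * ('X ^+ 2 - 1) : {poly int}) = 3.
    by rewrite -polyC_natr mul_polyC size_scale // natz; lia.
  by rewrite /quad_poly size_polyDl s3' // size_polyX.
- move=> z; apply/negP => /double_root_deriv [/rootP h1 /rootP].
  rewrite hq in h1; rewrite /complex_poly mapq /quad_poly -!polyC_natr !derivE !hornerE => h2.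
  have : (4 * n ^ 2 + 1)%:R = 0 :> R[i].
    have -> : (4 * n ^ 2 + 1)%:R = (n%:R * (z + z) + 1) ^+ 2 - 4 * n%:R * (n%:R * (z ^+ 2 - 1) + z).
      by rewrite natrD natrM natrX; ring.
    have -> : n%:R * (z + z) + 1 = 0 by rewrite -[RHS]h2; ring.
    by rewrite h1 expr0n mulr0 subr0.
  by move/eqP; rewrite pnatr_eq0; lia.
- move=> z w /rootP hz /rootP hw; apply/eqP => e.
  have ew : w = - z by apply/eqP; rewrite -addr_eq0 addrC e.
  rewrite hq in hz; rewrite hq ew in hw.
  have : z *+ 2 = 0.
    have -> : z *+ 2 = (n%:R * (z ^+ 2 - 1) + z) - (n%:R * ((- z) ^+ 2 - 1) - z) by ring.
    by rewrite hz hw subrr.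
  move/eqP; rewrite mulrn_eq0 /= => /eqP z0.
  by move/eqP: hz; rewrite z0 expr0n /= sub0r addr0 mulrN1 oppr_eq0 (negPf n0).
have [x [y [rx ry x0 y0 xy]]] := @quad_close_roots R n n2.
by exists x, y; split => //; apply: root_complex_poly; rewrite mapq.
Qed.

(** If both A = 2 and A = 3 gave a double root, these roots would be equal or
    opposite, as their squares are given by the same formula. *)
Lemma twin_family (R : realType) k n : (2 <= k)%N -> (3 * 2 ^ k.+1 <= n)%N ->
  exists2 A : nat, (2 <= A <= 3)%N &
  close_twin_roots k ((3 * 2 ^ k.+1)%:R / n%:R ^+ k : R) (twin_poly int k A n).
Proof.
move=> k2 Kn.
have n1 : (1 < n)%N by apply: leq_trans Kn; have := expn_gt0 2 k.+1; lia.
have k0 : (0 < k)%N by lia.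
have [A A23 nmr] : exists2 A : nat, (2 <= A <= 3)%N & no_multiple_root R (twin_poly int k A n).
  case: (pselect (no_multiple_root R (twin_poly int k 2 n))) => [h|/existsNP[z2 /negP/negPn d2]].
    by exists 2%N.
  case: (pselect (no_multiple_root R (twin_poly int k 3 n))) => [h|/existsNP[z3 /negP/negPn d3]].
    by exists 3%N.
  exfalso; have [r2 r2'] := double_root_deriv d2; have [r3 r3'] := double_root_deriv d3.
  rewrite /complex_poly map_twin_poly in r2 r2'; rewrite /complex_poly map_twin_poly in r3 r3'.
  case: k k0 r2 r2' r3 r3' {k2 Kn d2 d3} => // k _ r2 r2' r3 r3'.
  have e2 := twin_double_root n1 (isT : (0 < 2)%N) r2 r2'; have e3 := twin_double_root n1 (isT : (0 < 3)%N) r3 r3'.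
  have nz : n%:R * (n%:R - 1) - k.+1%:R * n%:R ^+ 2 != 0 :> R[i].
    have -> : n%:R * (n%:R - 1) - k.+1%:R * n%:R ^+ 2 = - (n * (1 + k * n))%:R :> R[i].
      by rewrite natrM natrD natrM -natr1; ring.
    by rewrite oppr_eq0 pnatr_eq0; nia.
  have : z2 ^+ 2 == z3 ^+ 2 by apply/eqP/(mulIf nz); rewrite e2 e3.
  rewrite eqf_sqr => /orP[] /eqP e.
    by rewrite e in r2; exact: (twin_root_common _ n1 _ r2 r3).
  by rewrite e in r2; apply: (twin_root_opp _ n1 _ r3 r2).
exists A => //; split => //.
- by apply: size_twin_poly; lia.
- rewrite /complex_poly map_twin_poly => z w rz rw; apply/eqP => e.
  have ew : w = - z by apply/eqP; rewrite -addr_eq0 addrC e.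
  by rewrite ew in rw; apply: (twin_root_opp _ n1 _ rz rw) => //; nia.
have [x [y [rx ry x0 y0 xy]]] := @twin_close_roots R k A n k2 A23 Kn.
by exists x, y; split => //; apply: root_complex_poly; rewrite map_twin_poly.
Qed.

(** Both families are of the form n U + V, with U and V in a finite set that
    does not depend on n; this bounds the height by a multiple of n. *)
Lemma sharp_family (R : realType) k : (0 < k)%N ->
  exists K C0 : nat, forall n, (C0 <= n)%N -> exists2 P : {poly int},
    (height P <= K * n)%N & close_twin_roots k (C0%:R / n%:R ^+ k : R) P.
Proof.
case: k => // -[|k] _.
  exists (height ('X ^+ 2 - 1) + height 'X)%N, 2%N => n n2; exists (quad_poly int n).
    by apply: height_natD; lia.
  have [s m d [x [y [rx ry x0 y0 xy]]]] := @quad_family R n n2.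
  split=> //; exists x, y; split => //; apply: le_trans xy _.
  by rewrite expr1 ler_peMl ?invr_ge0 // ler1n.
pose U A : {poly int} := A%:R * (1 + 'X) ^+ k.+2 * ('X - 1) + (1 - 'X) ^+ k.+2 * ('X + 1).
pose V A : {poly int} := A%:R * (1 + 'X) ^+ k.+2 - (1 - 'X) ^+ k.+2.
exists (height (U 2) + height (V 2) + (height (U 3) + height (V 3)))%N, (3 * 2 ^ k.+3)%N => n Kn.
have [A A23 tw] := @twin_family R k.+2 n isT Kn.
exists (twin_poly int k.+2 A n) => //.
have -> : twin_poly int k.+2 A n = n%:R * U A + V A by rewrite /twin_poly /U /V; ring.
have n0 : (0 < n)%N by apply: leq_trans Kn; have := expn_gt0 2 k.+3; lia.
apply: leq_trans (height_natD _ _ n0) _; rewrite leq_mul2r; apply/orP; right.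
have [->|->] : A = 2%N \/ A = 3%N by lia.
  exact: leq_addr.
exact: leq_addl.
Qed.

(** For polynomials of the family, c H^e is at least a constant times n^e0 with
    e0 = min(e, 0), and the distance is at most a constant times n^(1-d), where
    1 - d < e0: it suffices to take n large. *)
Lemma exponent_sharp (R : realType) (d : nat) (e c : R) :
  (2 <= d)%N -> - d%:R + 1 < e -> 0 < c ->
     exists P : {poly int},
       [/\ size P = d.+1,
           no_multiple_root R P,
           (forall z w : R[i], root (complex_poly R P) z ->
              root (complex_poly R P) w -> z + w != 0)
         & exists alpha beta : R,
             [/\ root (complex_poly R P) alpha%:C,
                 root (complex_poly R P) beta%:C,
                 alpha != beta
               & `| `|alpha| - `|beta| | < c * (height P)%:R `^ e]].
Proof.
case: d => // k k2 ke c0; have k0 : (0 < k)%N := k2.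
have [K [C0 fam]] := @sharp_family R k k0.
pose e0 := Num.min e 0.
have e00 : e0 <= 0 by rewrite ge_min lexx orbT.
have g0 : 0 < e0 + k%:R.
  by rewrite -ltrBlDr sub0r lt_min oppr_lt0 ltr0n k0 andbT; move: ke; rewrite -natr1; lra.
pose K1 : R := K.+1%:R.
pose W := C0%:R / (c * K1 `^ e0).
have K10 : 0 < K1 by rewrite ltr0n.
have cK : 0 < c * K1 `^ e0 by rewrite mulr_gt0 ?powR_gt0.
have W0 : 0 <= W by rewrite divr_ge0 // ltW.
pose n := (C0 + Num.Def.archi_bound (W `^ (e0 + k%:R)^-1)).+1.
have [P hP [sP mP dP [x [y [rx ry x0 y0 xy]]]]] := fam n (leq_trans (leq_addr _ _) (leqnSn _)).
exists P; split => //; exists x, y; split => //; first by rewrite gt_eqF // (lt_trans y0).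
rewrite (gtr0_norm x0) (ltr0_norm y0) opprK; apply: le_lt_trans xy _.
have n0 : (0 : R) < n%:R by rewrite ltr0n.
have P0 : P != 0 by rewrite -size_poly_eq0 sP.
have H1 : (1 : R) <= (height P)%:R by rewrite ler1n height_gt0.
have hK : (height P)%:R <= K1 * n%:R.
  by rewrite -natrM ler_nat; apply: leq_trans hP _; rewrite leq_mul2r leqnSn orbT.
have low : c * (K1 * n%:R) `^ e0 <= c * (height P)%:R `^ e.
  rewrite ler_pM2l //; apply: (@le_trans _ _ ((height P)%:R `^ e0)); last first.
    by apply: ler_powR => //; rewrite ge_min lexx.
  rewrite -[e0]opprK !(powRN _ (- e0)) lef_pV2 ?posrE ?powR_gt0 ?mulr_gt0 //; last first.
    exact: lt_le_trans H1.
  by apply: ge0_ler_powR; rewrite ?nnegrE ?oppr_ge0 ?mulr_ge0 // ?ltW // (lt_le_trans ltr01).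
apply: lt_le_trans low.
rewrite powRM ?ltW // ltr_pdivrMr ?exprn_gt0 //.
have -> : c * (K1 `^ e0 * n%:R `^ e0) * n%:R ^+ k = c * K1 `^ e0 * (n%:R `^ e0 * n%:R ^+ k) by ring.
rewrite -(powR_mulrn _ (ltW n0)) -powRD; last by rewrite gt_eqF ?implybT.
rewrite mulrC -ltr_pdivrMr // -/W.
have Wn : W `^ (e0 + k%:R)^-1 < n%:R.
  apply: lt_le_trans (archi_boundP _) _; first exact: powR_ge0.
  by rewrite ler_nat /n leqW // leq_addl.
have := gt0_ltr_powR g0 _ _ Wn.
rewrite !nnegrE powR_ge0 ler0n -powRrM mulVf ?gt_eqF // powRr1 //; exact.
Qed.

Theorem theorem1 (R : realType) :
  (forall (d : nat) (P : {poly int}) (alpha beta : R) (s : seq R[i]),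
     (2 <= d)%N ->
     size P = d.+1 ->
     no_multiple_root R P ->
     complex_poly R P =
       lead_coef (complex_poly R P)
         *: \prod_(z <- [:: alpha%:C, beta%:C & s]) ('X - z%:P) ->
     {in [:: alpha%:C, beta%:C & s] &, forall z w : R[i], z + w != 0} ->
     2 `^ ((- d%:R ^+ 2 + 2) / 2) * (d%:R + 1) `^ ((- d%:R + 1) / 2)
       * (height P)%:R `^ (- d%:R + 1)
     <= `| `|alpha| - `|beta| |)
  /\
  (forall (d : nat) (e c : R),
     (2 <= d)%N -> - d%:R + 1 < e -> 0 < c ->
     exists P : {poly int},
       [/\ size P = d.+1,
           no_multiple_root R P,
           (forall z w : R[i], root (complex_poly R P) z ->
              root (complex_poly R P) w -> z + w != 0)
         & exists alpha beta : R,
             [/\ root (complex_poly R P) alpha%:C,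
                 root (complex_poly R P) beta%:C,
                 alpha != beta
               & `| `|alpha| - `|beta| | < c * (height P)%:R `^ e]]).
Proof.
split; first exact: abs_separation_lower_bound.
exact: exponent_sharp.
Qed.
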